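(* Let $\hat p\in{}^*\mathbb N\setminus\mathbb N$ be a nonstandard prime and let $\mathbb R'\subseteq\mathbb F_{\hat p}$ be a subfield isomorphic (as a field) to $\mathbb R$. Then $\mathbb R'$ is not a $\sigma$-set, and $\mathbb R'$ is not a $\delta$-set.
   Context: Let $\mathcal F$ be a countably incomplete ultrafilter on a set $I$ and ${}^*\mathbb N=\mathbb N^I/\mathcal F$ the ultrapower, with $\mathbb N\subseteq{}^*\mathbb N$ via constant sequences. For a set $X$ let $V_0(X)=X$, $V_{n+1}(X)=V_n(X)\cup\mathcal P(V_n(X))$, $V(X)=\bigcup_n V_n(X)$, and let $*:V(\mathbb N)\to V({}^*\mathbb N)$ be the elementary embedding induced by the ultrapower. An element of $V({}^*\mathbb N)$ is internal if it is an element of ${}^*A$ for some $A\in V(\mathbb N)$. A nonstandard prime is an element $\hat p\in{}^*P\setminus\mathbb N$ where $P$ is the set of primes; $\mathbb F_{\hat p}=\{\hat n\in{}^*\mathbb N:\hat n<\hat p\}$ with addition and multiplication modulo $\hat p$ (an internal field of characteristic $0$). A set $S\subseteq{}^*\mathbb N$ is a $\sigma$-set if it is a union of countably many internal sets, and a $\delta$-set if it is an intersection of countably many internal sets. *)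

(* Defs.v *)
From HB Require Import structures.
From mathcomp Require Import all_boot all_order all_algebra.
From mathcomp Require Import mathcomp_extra boolp classical_sets functions filter.
From mathcomp Require Import reals.

Set Implicit Arguments.
Unset Strict Implicit.
Unset Printing Implicit Defensive.

Local Open Scope classical_set_scope.
Local Open Scope quotient_scope.

Definition countably_incomplete (I : Type) (F : set_system I) : Prop :=
  exists A : nat -> set I, (forall n, F (A n)) /\ ~ F (\bigcap_n A n).

Section Superstructure.
Variable X : Type.

(* The elements of X are urelements, so V_n(X) is contained in
   X `|` P(V_n(X)) by induction on n, whence V_{n+1}(X) is the disjoint union
   of X and P(V_n(X)); [Vlift] is the inclusion of V_n(X) in V_{n+1}(X). *)
Fixpoint Vlevel (n : nat) : Type :=
  if n is m.+1 then (X + set (Vlevel m))%type else X.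

Fixpoint Vlift (n : nat) : Vlevel n -> Vlevel n.+1 :=
  match n with
  | 0 => fun x => inl x
  | m.+1 => fun v => match v with
                     | inl x => inl x
                     | inr A => inr (@Vlift m @` A)
                     end
  end.

(* V(X), an element being given together with some n such that it lies in
   V_n(X); [Veq] is equality in V(X), irrespective of the chosen n. *)
Definition superstructure : Type := {n : nat & Vlevel n}.

Definition Vup (u : superstructure) : superstructure :=
  existT Vlevel (projT1 u).+1 (Vlift (projT2 u)).

Definition Veq (u v : superstructure) : Prop :=
  exists k l : nat, iter k Vup u = iter l Vup v.

Definition Vatom (x : X) : superstructure := existT Vlevel 0 x.

Definition Vset (n : nat) (A : set (Vlevel n)) : superstructure :=
  existT Vlevel n.+1 (inr A).

Definition Vmem (u v : superstructure) : Prop :=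
  exists (n : nat) (A : set (Vlevel n)) (a : Vlevel n),
    [/\ Veq v (Vset A), A a & Veq u (existT Vlevel n a)].

End Superstructure.

Section Ultrapower.
Context (I : Type) (F : set_system I) {FU : UltraFilter F}.

Definition eqF (f g : I -> nat) : bool := `[< F [set i | f i = g i] >].

Lemma eqF_refl : reflexive eqF.
Proof. by move=> f; apply/asboolP; apply: filterE. Qed.

Lemma eqF_sym : symmetric eqF.
Proof.
by move=> f g; apply/asboolP/asboolP; apply: filterS => i; exact: esym.
Qed.

Lemma eqF_trans : transitive eqF.
Proof.
move=> g f h /asboolP fg /asboolP gh; apply/asboolP.
by apply: filterS2 fg gh => i; exact: etrans.
Qed.

Canonical eqF_equiv : equiv_rel (I -> nat) :=
  EquivRel eqF eqF_refl eqF_sym eqF_trans.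

Definition starN : Type := {eq_quot eqF_equiv}.

Definition stc (f : I -> nat) : starN := \pi_({eq_quot eqF_equiv}) f.
Definition strep (x : starN) : I -> nat :=
  repr (x : {eq_quot eqF_equiv}).

Lemma strepK : cancel strep stc.
Proof. exact: reprK. Qed.

Lemma stcP (f g : I -> nat) : stc f = stc g <-> F [set i | f i = g i].
Proof.
split=> [fg|fg]; first by apply/asboolP/(eqmodP eqF_equiv).
exact/(eqmodP eqF_equiv)/asboolP.
Qed.

Definition stconst (n : nat) : starN := stc (fun=> n).

Definition stlt (x y : starN) : Prop := F [set i | strep x i < strep y i].
Definition stadd (x y : starN) : starN := stc (fun i => strep x i + strep y i).
Definition stmul (x y : starN) : starN := stc (fun i => strep x i * strep y i).
Definition stmod (x y : starN) : starN := stc (fun i => strep x i %% strep y i).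

Definition urelement (n : nat) (v : Vlevel nat n) : option nat :=
  match n return Vlevel nat n -> option nat with
  | 0 => fun x => Some x
  | _.+1 => fun v => if v is inl x then Some x else None
  end v.

(* The element of V( *N) represented by a sequence of elements of V_n(N): the
   ultrapower of V_n(N), transitively collapsed so that membership, which
   holds between two classes when it holds F-almost everywhere between their
   representatives, becomes true membership. *)
Fixpoint Vclass (n : nat) : (I -> Vlevel nat n) -> Vlevel starN n :=
  match n with
  | 0 => stc
  | m.+1 => fun f =>
      if `[< F [set i | urelement (f i) <> None] >]
      then inl (stc (fun i => odflt 0 (urelement (f i))))
      else inr (@Vclass m @`
             [set g | F [set i | if f i is inr A then A (g i) else False]])
  end.

Definition star (a : superstructure nat) : superstructure starN :=
  existT (Vlevel starN) (projT1 a) (Vclass (fun=> projT2 a)).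

Definition internal (u : superstructure starN) : Prop :=
  exists A : superstructure nat, Vmem u (star A).

Definition internal_set (S : set starN) : Prop :=
  internal (@Vset starN 0 S).

Definition sigma_set (S : set starN) : Prop :=
  exists A : nat -> set starN,
    (forall k, internal_set (A k)) /\ S = \bigcup_k A k.

Definition delta_set (S : set starN) : Prop :=
  exists A : nat -> set starN,
    (forall k, internal_set (A k)) /\ S = \bigcap_k A k.

Definition nonstandard_prime (p : starN) : Prop :=
  Vmem (Vatom p) (star (@Vset nat 0 [set n | prime n])) /\
  ~ (exists n : nat, p = stconst n).

Section Fp.
Variable p : starN.

Definition Fp : set starN := [set x | stlt x p].
Definition Fp_add (x y : starN) : starN := stmod (stadd x y) p.
Definition Fp_mul (x y : starN) : starN := stmod (stmul x y) p.

Definition Fp_subfield (S : set starN) : Prop :=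
  [/\ S `<=` Fp,
      S (stconst 0) /\ S (stconst 1),
      (forall x y, S x -> S y -> S (Fp_add x y) /\ S (Fp_mul x y)),
      (forall x, S x -> exists2 y, S y & Fp_add x y = stconst 0) &
      (forall x, S x -> x <> stconst 0 ->
         exists2 y, S y & Fp_mul x y = stconst 1)].

Definition Fp_isomorphic (K : fieldType) (S : set starN) : Prop :=
  exists phi : K -> starN,
    [/\ injective phi,
        range phi = S,
        (forall a b : K, phi (a + b)%R = Fp_add (phi a) (phi b)),
        (forall a b : K, phi (a * b)%R = Fp_mul (phi a) (phi b)) &
        phi 1%R = stconst 1].

End Fp.
End Ultrapower.

Arguments starN {I} F {FU}.

(* Main.v *)
Require Import Defs.
From mathcomp Require Import all_boot all_order all_algebra.
From mathcomp Require Import boolp classical_sets filter reals.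
From mathcomp Require Import functions cardinality ereal lebesgue_measure.
From mathcomp Require Import lra.

Import Order.TTheory GRing.Theory Num.Theory.

Set Implicit Arguments.
Unset Strict Implicit.
Unset Printing Implicit Defensive.

Local Open Scope classical_set_scope.
Local Open Scope ring_scope.

(** Write the internal sets as ultraproducts of sequences of sets of naturals,
    so that countable saturation applies to them, and use that in a copy [R']
    of the reals [a <= b] means that [b - a] is a square.

    If [R'] is the intersection of internal sets [A_k], then saturation gives
    [y] and [z_n] in all the [A_k], hence in [R'], with [y - n = z_n ^ 2] for
    all natural numbers [n]: finitely many of these conditions are satisfied by
    a large natural number [y] and the square roots of the [y - n]. Such a [y]
    contradicts the archimedean property.

    If [R'] is the union of an increasing sequence of internal sets [A_k], fix
    [k]. For each [n], saturation bounds the square roots that decide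
    whether [b - a <= 1 / (n + 1)], for [a] and [b] in [A_k], by a single
    [A_j], so that this relation is internal on [A_k]. By saturation again,
    there would be distinct infinitely close points in [A_k] unless the
    distances between distinct points of [A_k] are bounded below. So [A_k] is
    uniformly discrete, thus countable, and so would be the reals. *)

(** * Ultrafilters and countable saturation *)

Section UltrafilterFacts.
Context (I : Type) (F : set_system I) {FU : UltraFilter F}.

Lemma ultra_setC (A : set I) : ~ F A -> F (~` A).
Proof. by have [] := in_ultra_setVsetC A FU. Qed.

Lemma ultra_inhabited : inhabited I.
Proof. by have [i _] := @filter_ex _ F _ _ (@filterT _ F _). Qed.

Lemma filter_forall_leq (A : nat -> set I) (N : nat) :
  (forall k, (k <= N)%N -> F (A k)) ->
  F [set i | forall k, (k <= N)%N -> A k i].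
Proof.
elim: N => [|N IHN] FA.
  by apply: filterS (FA 0%N (leqnn _)) => i Ai k; rewrite leqn0 => /eqP->.
have FN : F [set i | forall k, (k <= N)%N -> A k i].
  by apply: IHN => k kN; apply: FA; exact: leqW.
apply: filterS2 FN (FA N.+1 (leqnn _)) => i Ale AN k.
by rewrite leq_eqVlt ltnS => /predU1P[->|/Ale].
Qed.

Lemma ultra_exists_leq (A : nat -> set I) (N : nat) :
  F [set i | exists2 k, (k <= N)%N & A k i] -> exists k, F (A k).
Proof.
move=> FA; apply: contrapT => /forallNP nFA.
have FnA : F [set i | forall k, (k <= N)%N -> (~` A k) i].
  by apply: filter_forall_leq => k _; exact: ultra_setC.
apply: (@filter_not_empty _ F); apply: filterS2 FA FnA => i [k kN Aki] nA.
exact: nA Aki.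
Qed.

Lemma filter_choice (T : Type) (x0 : T) (Q : I -> set T) :
  F [set i | exists x, Q i x] -> exists g : I -> T, F [set i | Q i (g i)].
Proof.
move=> FQ; have /choice[g gP] i : exists x, (exists x, Q i x) -> Q i x.
  have [[x Qx]|nQ] := pselect (exists x, Q i x); first by exists x.
  by exists x0 => /nQ.
by exists g; apply: filterS FQ => i /gP.
Qed.

Lemma countable_saturation (T : Type) (x0 : T) (P : nat -> I -> set T) :
  countably_incomplete F ->
  (forall n, F [set i | exists x, forall k, (k <= n)%N -> P k i x]) ->
  exists g : I -> T, forall k, F [set i | P k i (g i)].
Proof.
move=> [A [FA nFA]] FP.
(* The sets [A k] keep the intersection of the [D n] outside [F]; an index that solves every finite
   system need not solve the whole one. *)
pose D n i := (forall k, (k <= n)%N -> A k i) /\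
  exists x, forall k, (k <= n)%N -> P k i x.
have FD n : F (D n).
  by apply: filterI; [exact: (filter_forall_leq (A := A))|exact: FP].
have D_anti n m i : (m <= n)%N -> D n i -> D m i.
  by move=> mn [An [x Px]]; split=> [|]; [|exists x] => k km;
    [apply: An|apply: Px]; apply: leq_trans mn.
(* Almost every [i] leaves the decreasing sequence [D]; take a witness of the
   last [D n] that contains [i]. *)
have /choice[g gP] i : exists x, ~ (\bigcap_n A n) i ->
    forall k, D k i -> P k i x.
  have [|/existsNP[m /not_implyP[_ nAm]]] := pselect ((\bigcap_n A n) i).
    by exists x0.
  have nDm : ~ D m i by case=> Am _; apply/nAm/Am.
  have ltm k : D k i -> (k < m)%N.
    by move=> Dk; rewrite ltnNge; apply/negP => mk; apply/nDm/(D_anti k).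
  have [[n Dn]|/forallNP nD] := pselect (exists n, D n i); last first.
    by exists x0 => _ k /nD.
  have exD : exists n, `[< D n i >] by exists n; apply/asboolP.
  have leD k : `[< D k i >] -> (k <= m)%N by move=> /asboolP /ltm /ltnW.
  have [M /asboolP[_ [x Px]] maxM] := ex_maxnP exD leD.
  by exists x => _ k Dk; apply/Px/maxM/asboolP.
exists g => k; apply: filterS2 (ultra_setC nFA) (FD k) => i nA Dk.
exact: gP.
Qed.

End UltrafilterFacts.

(** * Cardinality and order of the reals *)

Section Reals.
Variable R : realType.

Lemma not_countable_setT : ~ countable [set: R].
Proof.
move=> cR.
have : countable (`[0, 1] : set R).
  by apply: sub_countable cR; exact: subset_card_le.
move=> /countable_lebesgue_measure0.
rewrite lebesgue_measure_itv/= lte_fin ltr01.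
by rewrite oppr0 adde0 => /eqP; rewrite onee_eq0.
Qed.

(** Points with the same integer part after scaling by [N.+1] are less than [N.+1%:R^-1] apart, so
    that integer part is an injective code. *)
Lemma uniformly_discrete_countable (B : set R) (N : nat) :
  (forall x y, B x -> B y -> `|x - y| < N.+1%:R^-1 -> x = y) -> countable B.
Proof.
move=> discB; apply/countable_injP.
exists (fun x => pickle (Num.floor (N.+1%:R * x))) => x y.
rewrite !inE => Bx By /(pcan_inj pickleK) exy; apply: discB => //.
have N0 : 0 < N.+1%:R :> R by rewrite ltr0n.
rewrite -[ltRHS]mul1r ltr_pdivlMr// -[X in _ * X]gtr0_norm// -normrM mulrBl.
have := floor_itv (N.+1%:R * x); have := floor_itv (N.+1%:R * y).
rewrite exy intrD ltr_norml => /andP[? ?] /andP[? ?]; apply/andP; split; lra.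
Qed.

(** An inequality and its reverse are each witnessed by an equation, which makes sense
    coordinatewise in an ultraproduct. *)
Lemma sqrt_dichotomy (a b : R) : exists c, b + c * c = a \/ a + c * c = b.
Proof.
have [ab|/ltW ba] := lerP a b.
  exists (Num.sqrt (b - a)); right.
  by rewrite -expr2 sqr_sqrtr ?subr_ge0// subrKC.
exists (Num.sqrt (a - b)); left.
by rewrite -expr2 sqr_sqrtr ?subr_ge0// subrKC.
Qed.

End Reals.

(** * A copy of the reals in an ultraproduct *)

Section RealSubfieldOfUltraproduct.
Context (R : realType) (I T : Type) (F : set_system I) {FU : UltraFilter F}.
Hypothesis Finc : countably_incomplete F.
Variables (ad mu : I -> T -> T -> T) (s : R -> I -> T).

(** The quotient is never formed: [s] selects one sequence per real, and equality in the
    ultraproduct is equality [F]-almost everywhere. *)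
Definition represents (f : I -> T) (a : R) := F [set i | f i = s a i].

Hypothesis sD : forall a b, represents (fun i => ad i (s a i) (s b i)) (a + b).
Hypothesis sM : forall a b, represents (fun i => mu i (s a i) (s b i)) (a * b).
Hypothesis s_inj : forall a b, represents (s a) b -> a = b.

Lemma represents_refl (a : R) : represents (s a) a.
Proof. exact: filterE. Qed.

Lemma representsD (f g : I -> T) (a b : R) : represents f a -> represents g b ->
  represents (fun i => ad i (f i) (g i)) (a + b).
Proof.
by move=> fa gb; apply: filterS3 fa gb (sD a b) => i /= -> ->.
Qed.

Lemma representsM (f g : I -> T) (a b : R) : represents f a -> represents g b ->
  represents (fun i => mu i (f i) (g i)) (a * b).
Proof.
by move=> fa gb; apply: filterS3 fa gb (sM a b) => i /= -> ->.
Qed.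

Lemma represents_eq (f g : I -> T) (a b : R) :
  represents f a -> represents g b -> F [set i | f i = g i] <-> a = b.
Proof.
move=> fa gb; split=> [fg|ab]; last first.
  by apply: filterS2 fa gb => i /= -> ->; rewrite ab.
by apply: s_inj; apply: filterS3 fa gb fg => i /= <- <-.
Qed.

(** * Countable intersections of internal sets *)

Lemma not_delta (A : nat -> I -> set T) :
  ~ (forall f, (exists a, represents f a) <->
               forall k, F [set i | A k i (f i)]).
Proof.
move=> RA.
have FA a k : F [set i | A k i (s a i)].
  by apply: (proj1 (RA _)); exists a; exact: represents_refl.
pose sqrel n i y z := ad i (mu i z z) (s n%:R i) = y.
(* A pair [(y, z)] in [P] for all [k] is an element [y] of the field with
   [y - n = (z n) ^ 2] for all natural numbers [n]. *)
pose P k i := [set yz : T * (nat -> T) | A k i yz.1 /\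
  forall n, (n <= k)%N -> forall l, (l <= k)%N ->
    A l i (yz.2 n) /\ sqrel n i yz.1 (yz.2 n)].
have [i0] := ultra_inhabited (F := F).
have Psat N : F [set i | exists x, forall k, (k <= N)%N -> P k i x].
  pose z n := Num.sqrt (N%:R - n%:R : R).
  have zP n : (n <= N)%N -> z n * z n + n%:R = N%:R.
    by move=> nN; rewrite -expr2 sqr_sqrtr ?subrK// subr_ge0 ler_nat.
  have FA1 : F [set i | forall k, (k <= N)%N -> A k i (s N%:R i)].
    apply: (filter_forall_leq (A := fun k i => A k i (s N%:R i))) => k _.
    exact: FA.
  have FA2 : F [set i | forall n, (n <= N)%N ->
      (forall l, (l <= N)%N -> A l i (s (z n) i)) /\
      sqrel n i (s N%:R i) (s (z n) i)].
    apply: (filter_forall_leq (A := fun n i =>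
      (forall l, (l <= N)%N -> A l i (s (z n) i)) /\
      sqrel n i (s N%:R i) (s (z n) i))) => n nN.
    apply: filterI.
      apply: (filter_forall_leq (A := fun l i => A l i (s (z n) i))) => l _.
      exact: FA.
    apply/(represents_eq _ (represents_refl _)); last exact: zP nN.
    by apply: representsD; [apply: representsM|]; exact: represents_refl.
  apply: filterS2 FA1 FA2 => i A1 A2.
  exists (s N%:R i, fun n => s (z n) i) => k kN; split; first exact: A1.
  move=> n nk l lk; have [A2l A2s] := A2 n (leq_trans nk kN).
  by split=> //; apply: A2l; exact: leq_trans lk kN.
have [g gP] := countable_saturation (s 0 i0, fun=> s 0 i0) Finc Psat.
have [y ry] : exists y, represents (fst \o g) y.
  by apply: (proj2 (RA _)) => k; apply: filterS (gP k) => i [].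
have ley n : n%:R <= y.
  have [z rz] : exists z, represents (fun i => (g i).2 n) z.
    (* The condition with index [maxn n k] reaches both the [n]-th root and the set [A k]. *)
    apply: (proj2 (RA _)) => k; apply: filterS (gP (maxn n k)) => i [_ Pi].
    by have [] := Pi n (leq_maxl _ _) k (leq_maxr _ _).
  have <- : z * z + n%:R = y.
    apply/(represents_eq _ ry).
      exact: (representsD (representsM rz rz) (represents_refl _)).
    apply: filterS (gP n) => i [_ Pi].
    by have [] := Pi n (leqnn _) n (leqnn _).
  by rewrite lerDr -expr2 sqr_ge0.
have y0 : 0 <= y := ley 0%N.
by have := archi_boundP y0; rewrite ltNge ley.
Qed.

(** * Countable unions of internal sets *)

Section Sigma.
Variable A : nat -> I -> set T.
Hypothesis A_mono : forall k l i, (k <= l)%N -> A k i `<=` A l i.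
Hypothesis RA : forall f, (exists a, represents f a) <->
  exists k, F [set i | A k i (f i)].

Let in_layer k := [set a | F [set i | A k i (s a i)]].

(** For representatives of reals, the root [z] witnesses y - x <= 1/(n+1), cleared of subtraction
    and division so that only [ad] and [mu] occur; [gap_ge] is the reverse inequality. *)
Let gap_le n i x y z :=
  ad i (mu i (s n.+1%:R i) y) (mu i z z) = ad i (mu i (s n.+1%:R i) x) (s 1 i).

Let gap_ge n i x y z :=
  ad i (ad i (mu i (s n.+1%:R i) x) (s 1 i)) (mu i z z) =
  mu i (s n.+1%:R i) y.

Let gap_leP n x y z a b c :
  represents x a -> represents y b -> represents z c ->
  F [set i | gap_le n i (x i) (y i) (z i)] <->
  n.+1%:R * b + c * c = n.+1%:R * a + 1.
Proof.
by move=> xa yb zc; apply: represents_eq; do !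
  [exact: represents_refl|assumption|apply: representsD|apply: representsM].
Qed.

Let gap_geP n x y z a b c :
  represents x a -> represents y b -> represents z c ->
  F [set i | gap_ge n i (x i) (y i) (z i)] <->
  n.+1%:R * a + 1 + c * c = n.+1%:R * b.
Proof.
by move=> xa yb zc; apply: represents_eq; do !
  [exact: represents_refl|assumption|apply: representsD|apply: representsM].
Qed.

Lemma layer_represents k (f : I -> T) :
  F [set i | A k i (f i)] -> exists a, represents f a.
Proof. by move=> FA; apply/RA; exists k. Qed.

(** If no layer sufficed, saturation would give a pair in [A k] without a witness in any layer; but
    the pair represents two reals, and the root from [sqrt_dichotomy] lies in some layer. *)
Lemma layer_gap_witness k n : exists j, F [set i | forall x y, A k i x ->
  A k i y -> exists2 z, A j i z & gap_le n i x y z \/ gap_ge n i x y z].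
Proof.
apply: contrapT => /forallNP nF.
pose P l i := [set xy : T * T | [/\ A k i xy.1, A k i xy.2 &
  forall z, A l i z -> ~ (gap_le n i xy.1 xy.2 z \/ gap_ge n i xy.1 xy.2 z)]].
have [i0] := ultra_inhabited (F := F).
have Psat N : F [set i | exists xy, forall l, (l <= N)%N -> P l i xy].
  apply: filterS (ultra_setC (nF N)) => i /existsNP[x /existsNP[y]].
  move=> /not_implyP[Ax /not_implyP[Ay nz]].
  exists (x, y) => l lN; split=> // z Alz gz.
  by apply: nz; exists z => //; exact: A_mono lN _ Alz.
have [g gP] := countable_saturation (s 0 i0, s 0 i0) Finc Psat.
have [a xa] : exists a, represents (fst \o g) a.
  by apply: (@layer_represents k); apply: filterS (gP 0%N) => i [].
have [b yb] : exists b, represents (snd \o g) b.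
  by apply: (@layer_represents k); apply: filterS (gP 0%N) => i [].
have [c abc] := sqrt_dichotomy (n.+1%:R * a + 1) (n.+1%:R * b).
have rc := represents_refl c.
have [l Al] : exists l, F [set i | A l i (s c i)] by apply/RA; exists c.
apply: (@filter_not_empty _ F).
case: abc => [/(gap_leP n xa yb rc)|/(gap_geP n xa yb rc)] Fg;
  apply: filterS3 Al (gP l) Fg => i Alc [_ _ nP] gi; apply: nP Alc _.
  by left.
by right.
Qed.

Lemma layer_discrete k : exists N : nat, forall a b, in_layer k a ->
  in_layer k b -> `|a - b| < N.+1%:R^-1 -> a = b.
Proof.
apply: contrapT => /forallNP close.
have /choice[j jP] := layer_gap_witness k.
(* Witnesses are confined to [A (j n)] because a square root elsewhere in the ultraproduct need not
   represent a real, and its square would say nothing about the order. *)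
pose P n i := [set xy : T * T | [/\ A k i xy.1, A k i xy.2, xy.1 <> xy.2,
  exists2 z, A (j n) i z & gap_le n i xy.1 xy.2 z &
  exists2 z, A (j n) i z & gap_le n i xy.2 xy.1 z]].
have [i0] := ultra_inhabited (F := F).
(* If [gap_le] failed almost everywhere, the witnesses from [jP] would satisfy [gap_ge] and
   represent a real, against the strict bound. *)
have gap_lt n a b : in_layer k a -> in_layer k b -> b - a < n.+1%:R^-1 ->
    F [set i | exists2 z, A (j n) i z & gap_le n i (s a i) (s b i) z].
  rewrite /in_layer/= -[ltRHS]mul1r ltr_pdivlMr ?ltr0n// => Aa Ab ab1.
  have [//|nF] := pselect (F [set i | exists2 z, A (j n) i z &
    gap_le n i (s a i) (s b i) z]).
  have : F [set i | exists z, A (j n) i z /\ gap_ge n i (s a i) (s b i) z].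
    have FA : F [set i | A k i (s a i) /\ A k i (s b i)] by exact: filterI.
    apply: filterS3 (jP n) FA (ultra_setC nF) => i Hj [Aai Abi] nz.
    have [z Az [gz|gz]] := Hj _ _ Aai Abi; last by exists z.
    by case: nz; exists z.
  move=> /(filter_choice (s 0 i0))[z zP].
  have [c zc] : exists c, represents z c.
    by apply: (@layer_represents (j n)); apply: filterS zP => i [].
  have : F [set i | gap_ge n i (s a i) (s b i) (z i)].
    by apply: filterS zP => i [].
  move=> /(gap_geP n (represents_refl a) (represents_refl b) zc) abc.
  have : 0 <= c * c by rewrite -expr2 sqr_ge0.
  lra.
have Psat N : F [set i | exists xy, forall n, (n <= N)%N -> P n i xy].
  have /existsNP[a /existsNP[b]] := close N.
  move=> /not_implyP[Aa /not_implyP[Ab /not_implyP[ab neab]]].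
  have Fne : F [set i | s a i <> s b i].
    by apply: ultra_setC => /s_inj.
  have lt_inv n : (n <= N)%N -> N.+1%:R^-1 <= n.+1%:R^-1 :> R.
    by move=> nN; rewrite lef_pV2 ?posrE ?ltr0n// ler_nat.
  have FP : F [set i | forall n, (n <= N)%N -> P n i (s a i, s b i)].
    apply: (filter_forall_leq (A := fun n i => P n i (s a i, s b i))) => n nN.
    have lt1 : b - a < n.+1%:R^-1.
      apply: lt_le_trans (lt_inv _ nN).
      by rewrite (le_lt_trans _ ab)// distrC ler_norm.
    have lt2 : a - b < n.+1%:R^-1.
      apply: lt_le_trans (lt_inv _ nN).
      by rewrite (le_lt_trans _ ab)// ler_norm.
    have H : F [set i | (A k i (s a i) /\ A k i (s b i)) /\ s a i <> s b i].
      by apply: filterI Fne; exact: filterI.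
    apply: filterS3 (gap_lt _ _ _ Aa Ab lt1) (gap_lt _ _ _ Ab Aa lt2) H.
    by move=> i ? ? [[? ?] ?]; split.
  by apply: filterS FP => i Pi; exists (s a i, s b i).
have [g gP] := countable_saturation (s 0 i0, s 0 i0) Finc Psat.
have [a xa] : exists a, represents (fst \o g) a.
  by apply: (@layer_represents k); apply: filterS (gP 0%N) => i [].
have [b yb] : exists b, represents (snd \o g) b.
  by apply: (@layer_represents k); apply: filterS (gP 0%N) => i [].
have gap_le_bound n f h c d : represents f c -> represents h d ->
    F [set i | exists2 z, A (j n) i z & gap_le n i (f i) (h i) z] ->
    n.+1%:R * (d - c) <= 1.
  move=> fc hd FZ; have [z zP] : exists z : I -> T,
      F [set i | A (j n) i (z i) /\ gap_le n i (f i) (h i) (z i)].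
    apply: (@filter_choice _ _ _ _ (s 0 i0) (fun i => [set z |
      A (j n) i z /\ gap_le n i (f i) (h i) z])).
    by apply: filterS FZ => i [z]; exists z.
  have [e ze] : exists e, represents z e.
    by apply: (@layer_represents (j n)); apply: filterS zP => i [].
  have : F [set i | gap_le n i (f i) (h i) (z i)].
    by apply: filterS zP => i [].
  move=> /(gap_leP n fc hd ze).
  have : 0 <= e * e by rewrite -expr2 sqr_ge0.
  lra.
have neab : a != b.
  apply/eqP => /(represents_eq xa yb) Fab; apply: (@filter_not_empty _ F).
  by apply: filterS2 Fab (gP 0%N) => i /= ? [].
have dist_le n : n.+1%:R * `|a - b| <= 1.
  have [_|_] := lerP a b.
    apply: gap_le_bound xa yb _.
    by apply: filterS (gP n) => i [].
  apply: gap_le_bound yb xa _.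
  by apply: filterS (gP n) => i [].
have d0 : 0 < `|a - b| by rewrite normr_gt0 subr_eq0.
(* A natural number [m] above the inverse of the distance contradicts [dist_le m]. *)
have := archi_boundP (ltW (divr_gt0 ltr01 d0)).
set m := Num.bound _; have := dist_le m.
rewrite ltr_pdivrMr// -natr1 mulrDl mul1r => le1 lt1.
lra.
Qed.

Lemma increasing_not_sigma : False.
Proof.
apply: (@not_countable_setT R).
have -> : [set: R] = \bigcup_k in_layer k.
  apply/seteqP; split=> // a _.
  have [k Ak] : exists k, F [set i | A k i (s a i)].
    by apply/RA; exists a; exact: represents_refl.
  by exists k.
apply: bigcup_countable => [|k _]; first exact: countableP.
have [N] := layer_discrete k; exact: uniformly_discrete_countable.
Qed.

End Sigma.

Lemma not_sigma (A : nat -> I -> set T) :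
  ~ (forall f, (exists a, represents f a) <->
               exists k, F [set i | A k i (f i)]).
Proof.
(* Finite unions make the layers increasing, and a sequence almost everywhere in a finite union is
   almost everywhere in one of its terms. *)
move=> RA; pose B k i := [set x | exists2 l, (l <= k)%N & A l i x].
apply: (@increasing_not_sigma B) => [k l i kl x [m mk Am]|f].
  by exists m => //; exact: leq_trans kl.
rewrite RA; split=> [[k FA]|[k /ultra_exists_leq[l FA]]]; last by exists l.
by exists k; apply: filterS FA => i Ai; exists k.
Qed.


End RealSubfieldOfUltraproduct.

(* Internal sets as ultraproducts *)
Local Close Scope ring_scope.

Definition urel (X : Type) n : X -> Vlevel X n :=
  if n is m.+1 then fun x => inl x else fun x => x.

Lemma urel_inj X n : injective (@urel X n).
Proof. by case: n => [|n] x y //= []. Qed.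

Lemma Vlift_urel X n (x : X) : Vlift (urel n x) = urel n.+1 x.
Proof. by case: n. Qed.

Section InternalSets.
Context (I : Type) (F : set_system I) {FU : UltraFilter F}.

Lemma strep_stc (f : I -> nat) : F [set i | strep (stc (F := F) f) i = f i].
Proof. by apply/stcP; rewrite strepK. Qed.

Lemma Vclass_ae_eq n (f g : I -> Vlevel nat n) :
  F [set i | f i = g i] -> Vclass (F := F) f = Vclass (F := F) g.
Proof.
case: n f g => [f g fg|n f g fg]; first exact/stcP.
have fgP (P : Vlevel nat n.+1 -> I -> Prop) :
    F [set i | P (f i) i] = F [set i | P (g i) i].
  by apply/propext; split=> FP; apply: filterS2 fg FP => i /= ->.
rewrite /= (fgP (fun v _ => urelement v <> None)).
congr (if _ then inl _ else inr _).
  by apply/stcP; apply: filterS fg => i /= ->.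
congr (_ @` _); apply/funext => h.
exact: (fgP (fun v i => if v is inr A then A (h i) else False)).
Qed.

Lemma urelement_lift n (v : Vlevel nat n) : urelement (Vlift v) = urelement v.
Proof. by case: n v => [|n] // []. Qed.

(** Puts the urelement test in a prescribed form [u], so that a sequence and its lift branch on the
    same condition. *)
Lemma VclassS n (f : I -> Vlevel nat n.+1) (u : I -> option nat) :
  (fun i => urelement (f i)) = u ->
  Vclass (F := F) f =
  if `[< F [set i | u i <> None] >] then inl (stc (fun i => odflt 0 (u i)))
  else inr (Vclass (n := n) @`
         [set g | F [set i | if f i is inr A then A (g i) else False]]).
Proof. by move=> <-. Qed.

(** A member of a lifted set is almost everywhere the lift of a member, and [filter_choice] selects
    these preimages as one sequence. *)
Lemma Vlift_Vclass n (f : I -> Vlevel nat n) :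
  Vlift (Vclass (F := F) f) = Vclass (F := F) (fun i => Vlift (f i)).
Proof.
elim: n f => [|n IHn] f.
  by rewrite /= asboolT//; apply: filterE => i.
have uf : (fun i => urelement (Vlift (f i))) = (fun i => urelement (f i)).
  by apply/funext => i; rewrite urelement_lift.
rewrite (VclassS erefl) (VclassS uf).
case: ifP => // _; congr inr; apply/seteqP; split.
  move=> _ [_ [g gf <-] <-]; exists (fun i => Vlift (g i)); last exact/esym/IHn.
  by apply: filterS gf => i /=; case: (f i) => // A Ag; exists (g i).
move=> _ [h hf <-].
have [g gP] : exists g : I -> Vlevel nat n, F [set i |
    (if f i is inr A then A (g i) else False) /\ Vlift (g i) = h i].
  apply: (@filter_choice _ _ _ _ (urel n 0) (fun i => [set v |
    (if f i is inr A then A v else False) /\ Vlift v = h i])).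
  apply: filterS hf => i /=; case: (f i) => // A [v Av vh].
  by exists v.
exists (Vclass (F := F) g).
  by exists g => //; apply: filterS gP => i [].
apply: etrans (IHn g) _; apply: Vclass_ae_eq.
by apply: filterS gP => i [].
Qed.

(** [star] collapses constant sequences, but the members of the resulting sets come from arbitrary
    ones. *)
Definition ultraclass (u : superstructure (starN F)) : Prop :=
  exists n (f : I -> Vlevel nat n), u = existT _ n (Vclass (F := F) f).

Lemma ultraclass_Vup u : ultraclass u -> ultraclass (Vup u).
Proof.
move=> [n [f ->]]; exists n.+1, (fun i => Vlift (f i)).
by rewrite -Vlift_Vclass.
Qed.

Lemma ultraclass_iter k u : ultraclass u -> ultraclass (iter k (@Vup _) u).
Proof. by move=> cu; elim: k => //= k; exact: ultraclass_Vup. Qed.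

Lemma ultraclass_Vset n (B : set (Vlevel (starN F) n)) :
  ultraclass (Vset B) ->
  exists f : I -> Vlevel nat n.+1, inr B = Vclass (F := F) f.
Proof.
move=> [m [f e]]; have em : n.+1 = m := f_equal (@projT1 _ _) e.
case: m / em f e => f e; exists f.
exact: (Eqdep_dec.inj_pair2_eq_dec _ PeanoNat.Nat.eq_dec _ _ _ _ e).
Qed.

Lemma ultraclass_mem n (B : set (Vlevel (starN F) n)) b :
  ultraclass (Vset B) -> B b -> ultraclass (existT _ n b).
Proof.
move=> /ultraclass_Vset[f] /=; case: ifP => // _ [->] [g _ <-].
by exists n, g.
Qed.

Lemma iter_Vup_Vset l n (B : set (Vlevel (starN F) n)) b : B b ->
  exists m (C : set (Vlevel (starN F) m)) c,
    [/\ iter l (@Vup _) (Vset B) = Vset C, C c &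
        iter l (@Vup _) (existT _ n b) = existT _ m c].
Proof.
move=> Bb; elim: l => [|l [m [C [c [eC Cc ec]]]]]; first by exists n, B, b.
by exists m.+1, (@Vlift _ m @` C), (Vlift c); split => [||];
  rewrite /= ?eC ?ec//; exists c.
Qed.

Lemma internal_ultraclass u : internal u ->
  exists k, ultraclass (iter k (@Vup _) u).
Proof.
move=> [A [n [B [b [[k [l ekl]] Bb [k' [l' ekl']]]]]]].
(* The equalities in [Vmem] hold only after lifting; [b] and [B] are lifted together until [B]
   becomes a lift of [star A]. *)
have [m [C [c [eC Cc ec]]]] := iter_Vup_Vset l Bb.
have cC : ultraclass (Vset C).
  rewrite -eC -ekl; apply: ultraclass_iter.
  by exists (projT1 A), (fun=> projT2 A).
exists (l + k'); rewrite iterD ekl' -iterD addnC iterD ec.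
exact/ultraclass_iter/(ultraclass_mem cC).
Qed.

Lemma iter_Vup_set0 k (S : set (starN F)) :
  iter k (@Vup _) (@Vset _ 0 S) = @Vset _ k (@urel _ k @` S).
Proof.
elim: k => [|k IHk]; first by rewrite image_id.
rewrite iterS IHk.
have <- : @Vlift _ k @` (@urel _ k @` S) = @urel _ k.+1 @` S.
  by rewrite image_comp; apply: eq_imagel => x _; exact: Vlift_urel.
by [].
Qed.

Lemma Vclass_urel n (f : I -> nat) :
  Vclass (F := F) (fun i => urel n (f i)) = urel n (stc f).
Proof. by case: n => //= n; rewrite asboolT//; apply: filterE. Qed.

Lemma Vclass_urel_inv n (f : I -> Vlevel nat n) x :
  Vclass (F := F) f = urel n x -> F [set i | f i = urel n (strep x i)].
Proof.
case: n f => [|n] f /=; first by move=> <-; apply: filterS (strep_stc f).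
case: ifP => // /asboolP Fu [<-].
apply: filterS2 (strep_stc (fun i => odflt 0 (urelement (f i)))) Fu => i /= ->.
by case: (f i).
Qed.

Lemma internal_setP (S : set (starN F)) : internal_set S ->
  exists a : I -> set nat, forall f, S (stc f) <-> F [set i | a i (f i)].
Proof.
move=> /internal_ultraclass[k]; rewrite iter_Vup_set0 => /ultraclass_Vset[h].
move=> /=; case: ifP => // _ [eS].
(* A term [h i] contributes the naturals whose level-[k] copies it contains; a term that is itself a
   urelement counts as the empty set. *)
exists (fun i n => if h i is inr A then A (urel k n) else False) => f.
have memS x : S x <-> (@urel _ k @` S) (urel k x).
  by split=> [Sx|[y Sy exy]]; [exists x|rewrite -(urel_inj exy)].
rewrite memS eS; split=> [[g hg eg]|Fh]; last first.
  by exists (fun i => urel k (f i)); rewrite ?Vclass_urel.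
have := Vclass_urel_inv eg; move: hg.
by apply: filterS3 (strep_stc f) => i /= -> + gi; rewrite gi.
Qed.

End InternalSets.

(** * Application to subfields of [Fp p] *)

Theorem theorem0p5 (R : realType) (I : Type) (F : set_system I)
    (FU : UltraFilter F) (Finc : countably_incomplete F)
    (p : starN F) (hp : nonstandard_prime p)
    (R' : set (starN F)) (subR' : Fp_subfield p R')
    (isoR' : Fp_isomorphic p R R') :
  ~ sigma_set R' /\ ~ delta_set R'.
Proof.
case: isoR' => phi [phi_inj <- phiD phiM _].
pose s a := strep (phi a).
pose ad i x y := (x + y) %% strep p i.
pose mu i x y := (x * y) %% strep p i.
have repP f a : represents F s f a <-> stc f = phi a.
  by rewrite -[phi a]strepK stcP.
have sD a b : represents F s (fun i => ad i (s a i) (s b i)) (a + b)%R.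
  apply/repP; rewrite phiD; apply/stcP.
  (* [Fp_add] reduces a chosen representative of the sum, which agrees with the pointwise sum only
     almost everywhere. *)
  by apply: filterS (strep_stc (fun i => s a i + s b i)) => i /= ->.
have sM a b : represents F s (fun i => mu i (s a i) (s b i)) (a * b)%R.
  apply/repP; rewrite phiM; apply/stcP.
  by apply: filterS (strep_stc (fun i => s a i * s b i)) => i /= ->.
have s_inj a b : represents F s (s a) b -> a = b.
  by move=> /repP; rewrite strepK => /phi_inj.
have rangeP f : range phi (stc f) <-> exists a, represents F s f a.
  by split=> [[a _ fa]|[a /repP fa]]; exists a => //; apply/repP.
split=> -[A [intA RA]].
  have /choice[B BP] k := internal_setP (intA k).
  apply: (not_sigma Finc sD sM s_inj (A := B)) => f; rewrite -rangeP RA.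
  by split=> [[k _ /BP]|[k /BP]]; exists k.
have /choice[B BP] k := internal_setP (intA k).
apply: (not_delta Finc sD sM s_inj (A := B)) => f; rewrite -rangeP RA.
by split=> Af k => [|_]; apply/BP; apply: Af.
Qed.
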